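(* Let $n\ge3$, $m\ge2$. For every skew shape $\lambda/\mu$ and every $r\in\mathbb{Z}/n\mathbb{Z}$, the quantum loop Schur function satisfies $s^{(r)}_{\lambda/\mu}(\mathbf{q}_1,\dots,\mathbf{q}_m)\in\mathcal{Q}_\epsilon^{\mathfrak{S}_m}$.
   Context: Second (equivalently, upper) indices are taken in $\mathbb{Z}/n\mathbb{Z}$, $\epsilon$ is a central indeterminate, and we write $q_j^{(i)}=q_{j,i}$. For $k\in\mathbb{Z}/n\mathbb{Z}$ let $S_k$ be the set of $q_{j,i}$ with $i+j\equiv1+k\pmod n$. $\mathcal{Q}_\epsilon=\mathbb{Q}_\epsilon\langle\mathbf{q}_1,\dots,\mathbf{q}_m\rangle$, $\mathbf{q}_j=(q_{j,i})_{i}$, is the skew field of fractions of the quantum torus over $\mathbb{Z}[\epsilon,\epsilon^{-1}]$ generated by the $q_{j,i}^{\pm1}$ ($1\le j\le m$, $i\in\mathbb{Z}/n\mathbb{Z}$) with relations $$q_{j,i}q_{j',i'}=\begin{cases}\epsilon\,q_{j',i'}q_{j,i}&q_{j,i}\in S_{k+1},\ q_{j',i'}\in S_k,\ j\le j',\\ \epsilon^{-1}q_{j',i'}q_{j,i}&q_{j,i}\in S_{k+1},\ q_{j',i'}\in S_k,\ j>j',\\ \epsilon^{-2}q_{j',i'}q_{j,i}&q_{j,i},q_{j',i'}\in S_k,\ j<j',\\ \epsilon^{2}q_{j',i'}q_{j,i}&q_{j,i},q_{j',i'}\in S_k,\ j>j',\\ q_{j',i'}q_{j,i}&\text{if neither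 } (q_{j,i},q_{j',i'}) \text{ nor } (q_{j',i'},q_{j,i}) \text{ is covered by the previous cases.}\end{cases}$$ Quantum geometric $R$-matrix: for $1\le j\le m-1$ write $p_i=q_{j,i}$, $q_i=q_{j+1,i}$, and $$\kappa_i^\epsilon=\sum_{h=0}^{n-1}p_{i-1}p_{i-2}\cdots p_{i-h}\,q_{i-h-2}q_{i-h-3}\cdots q_{i-n}\qquad(\text{factors in this order}).$$ $R_j^\epsilon:\mathcal{Q}_\epsilon\to\mathcal{Q}_\epsilon$ is the morphism of skew fields with $R_j^\epsilon(p_i)=(\kappa_i^\epsilon)^{-1}q_i\,\kappa_{i+1}^\epsilon$, $R_j^\epsilon(q_i)=(\kappa_{i+1}^\epsilon)^{-1}p_i\,\kappa_i^\epsilon$, fixing $\epsilon$ and all $q_{j',i}$ with $j'\ne j,j+1$. The $R_j^\epsilon$ generate an action of $\mathfrak{S}_m$ on $\mathcal{Q}_\epsilon$, and $\mathcal{Q}_\epsilon^{\mathfrak{S}_m}$ denotes the set of elements fixed by all of $R_1^\epsilon,\dots,R_{m-1}^\epsilon$. Quantum loop Schur functions: use English notation for Young diagrams; the content of a box $b$ in row $i$ and column $j$ is $c(b)=i-j$. A semistandard tableau $T$ of shape $\lambda/\mu$ has entries weakly increasing along rows (left to right) and strictly increasing down columns. Its $r$-reading word is the monomial $$\mathrm{wt}_\epsilon^{(r)}(T)=\prod_{b\in\lambda/\mu}q_{T(b)}^{(c(b)-T(b)+r+1)}\in\mathcal{Q}_\epsilon,$$ the noncommutative product being taken by reading the columns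 from left to right, each column from top to bottom. Then $s^{(r)}_{\lambda/\mu}(\mathbf{q}_1,\dots,\mathbf{q}_m)=\sum_T\mathrm{wt}_\epsilon^{(r)}(T)$, the sum being over all semistandard Young tableaux $T$ of shape $\lambda/\mu$ with entries in $\{1,\dots,m\}$. *)

(* Defs.v *)
From HB Require Import structures.
From mathcomp Require Import all_boot all_order all_algebra.

Set Implicit Arguments.
Unset Strict Implicit.
Unset Printing Implicit Defensive.

Import GRing.Theory.

Local Open Scope ring_scope.

(* A family of generators is a function q : nat -> 'Z_n -> A; only the values *)
(* q j i with 1 <= j <= m are meaningful.  All notions assume 1 < n, so that  *)
(* 'Z_n is the ring of integers modulo n.                                     *)

Definition in_S (n : nat) (k : 'Z_n) (j : nat) (i : 'Z_n) : bool :=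
  i + j%:R == 1 + k.

(* (q_{j,i}, q_{j',i'}) falls under one of the first four cases of the        *)
(* commutation relations below.                                               *)
Definition covered (n : nat) (j : nat) (i : 'Z_n) (j' : nat) (i' : 'Z_n)
    : bool :=
  [exists k : 'Z_n, in_S (k + 1) j i && in_S k j' i'] ||
  [exists k : 'Z_n, [&& in_S k j i, in_S k j' i' & j != j']].

Record torus_relations (n m : nat) (A : unitRingType)
    (eps : A) (q : nat -> 'Z_n -> A) : Prop := TorusRelations {
  eps_unit : eps \is a GRing.unit;
  eps_central : forall x : A, eps * x = x * eps;
  gen_unit : forall j i, (1 <= j <= m)%N -> q j i \is a GRing.unit;
  gen_succ_le : forall k j i j' i',
    (1 <= j <= m)%N -> (1 <= j' <= m)%N ->
    in_S (k + 1) j i -> in_S k j' i' -> (j <= j')%N ->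
    q j i * q j' i' = eps * q j' i' * q j i;
  gen_succ_gt : forall k j i j' i',
    (1 <= j <= m)%N -> (1 <= j' <= m)%N ->
    in_S (k + 1) j i -> in_S k j' i' -> (j > j')%N ->
    q j i * q j' i' = eps^-1 * q j' i' * q j i;
  gen_same_lt : forall k j i j' i',
    (1 <= j <= m)%N -> (1 <= j' <= m)%N ->
    in_S k j i -> in_S k j' i' -> (j < j')%N ->
    q j i * q j' i' = eps ^- 2 * q j' i' * q j i;
  gen_same_gt : forall k j i j' i',
    (1 <= j <= m)%N -> (1 <= j' <= m)%N ->
    in_S k j i -> in_S k j' i' -> (j > j')%N ->
    q j i * q j' i' = eps ^+ 2 * q j' i' * q j i;
  gen_comm : forall j i j' i',
    (1 <= j <= m)%N -> (1 <= j' <= m)%N ->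
    ~~ covered j i j' i' -> ~~ covered j' i' j i ->
    q j i * q j' i' = q j' i' * q j i
}.

Definition maps_gens (n m : nat) (A B : unitRingType)
    (eps : A) (q : nat -> 'Z_n -> A) (eps' : B) (q' : nat -> 'Z_n -> B)
    (f : A -> B) : Prop :=
  f eps = eps' /\ forall j i, (1 <= j <= m)%N -> f (q j i) = q' j i.

(* The quantum torus is the ring presented by the generators eps^{+-1},       *)
(* q_{j,i}^{+-1} and the relations above, i.e. the initial such ring. A ring  *)
(* with a central unit eps is the same as a Z[eps, eps^-1]-algebra.           *)
Definition is_quantum_torus (n m : nat) (A : unitRingType)
    (eps : A) (q : nat -> 'Z_n -> A) : Prop :=
  torus_relations m eps q /\
  forall (B : unitRingType) (eps' : B) (q' : nat -> 'Z_n -> B),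
    torus_relations m eps' q' ->
    (exists f : {rmorphism A -> B}, maps_gens m eps q eps' q' f) /\
    (forall f g : {rmorphism A -> B},
       maps_gens m eps q eps' q' f -> maps_gens m eps q eps' q' g -> f =1 g).

Definition skew_field (Q : unitRingType) : Prop :=
  forall x : Q, x != 0 -> x \is a GRing.unit.

(* Right fractions; for an Ore domain these are the same as left fractions.   *)
Definition is_skew_field_of_fractions (A Q : unitRingType)
    (iota : {rmorphism A -> Q}) : Prop :=
  [/\ skew_field Q, injective iota
    & forall x : Q, exists a b : A, b != 0 /\ x = iota a / iota b].

(* Q, together with eps and q, is Q_eps<q_1, ..., q_m> *)
Definition is_Q_eps (n m : nat) (Q : unitRingType)
    (eps : Q) (q : nat -> 'Z_n -> Q) : Prop :=
  exists (A : unitRingType) (epsA : A) (qA : nat -> 'Z_n -> A)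
         (iota : {rmorphism A -> Q}),
    [/\ is_quantum_torus m epsA qA, is_skew_field_of_fractions iota
      & maps_gens m epsA qA eps q iota].

Definition kappa (n : nat) (Q : unitRingType) (p q : 'Z_n -> Q) (i : 'Z_n)
    : Q :=
  \sum_(0 <= h < n)
    (\prod_(1 <= a < h.+1) p (i - a%:R)) *
    (\prod_(h.+2 <= a < n.+1) q (i - a%:R)).

Record is_geometric_R (n m : nat) (Q : unitRingType)
    (eps : Q) (q : nat -> 'Z_n -> Q) (j : nat) (R : {rmorphism Q -> Q})
    : Prop := IsGeometricR {
  geomR_eps : R eps = eps;
  geomR_p : forall i, R (q j i) =
    (kappa (q j) (q j.+1) i)^-1 * q j.+1 i * kappa (q j) (q j.+1) (i + 1);
  geomR_q : forall i, R (q j.+1 i) =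
    (kappa (q j) (q j.+1) (i + 1))^-1 * q j i * kappa (q j) (q j.+1) i;
  geomR_other : forall j' i, (1 <= j' <= m)%N -> j' != j -> j' != j.+1 ->
    R (q j' i) = q j' i
}.

Definition Sym_invariant (m : nat) (Q : unitRingType)
    (R : nat -> {rmorphism Q -> Q}) (x : Q) : Prop :=
  forall j, (1 <= j < m)%N -> R j x = x.

(* Trailing zeros are allowed. *)
Definition is_partition (lam : seq nat) : bool := sorted geq lam.

Definition is_skew_shape (lam mu : seq nat) : Prop :=
  [/\ is_partition lam, is_partition mu
    & forall i, (nth 0%N mu i <= nth 0%N lam i)%N].

(* Rows and columns are numbered from 0; contents are unaffected. *)
Definition in_skew (lam mu : seq nat) (i j : nat) : bool :=
  (nth 0%N mu i <= j < nth 0%N lam i)%N.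

(* A filling of lam/mu is extended by 0 to the bounding rectangle of lam, so  *)
(* that semistandard tableaux correspond bijectively to elements of ssyt.     *)
Definition filling (m : nat) (lam : seq nat) : finType :=
  {ffun 'I_(size lam) * 'I_(head 0%N lam) -> 'I_m.+1}.

Definition ssyt (m : nat) (lam mu : seq nat) : {set filling m lam} :=
  let row := 'I_(size lam) in
  let column := 'I_(head 0%N lam) in
  [set T : filling m lam |
    [&& [forall i : row, forall j : column,
           if in_skew lam mu i j then (0 < T (i, j))%N
           else T (i, j) == ord0],
        [forall i : row, forall j : column, forall j' : column,
           [&& in_skew lam mu i j, in_skew lam mu i j' & (j < j')%N] ==>
           (T (i, j) <= T (i, j'))%N]
      & [forall i : row, forall i' : row, forall j : column,
           [&& in_skew lam mu i j, in_skew lam mu i' j & (i < i')%N] ==>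
           (T (i, j) < T (i', j))%N]]].

(* Big products over ordinals are taken in increasing order of the index. *)
Definition tab_weight (n m : nat) (Q : unitRingType) (q : nat -> 'Z_n -> Q)
    (lam mu : seq nat) (r : 'Z_n) (T : filling m lam) : Q :=
  \prod_(j < head 0%N lam) \prod_(i < size lam | in_skew lam mu i j)
    q (T (i, j)) (i%:R - j%:R - (T (i, j))%:R + r + 1).

Definition loop_schur (n m : nat) (Q : unitRingType) (q : nat -> 'Z_n -> Q)
    (lam mu : seq nat) (r : 'Z_n) : Q :=
  \sum_(T in ssyt m lam mu) tab_weight q mu r T.

(* Main.v *)
Require Import Defs.
From HB Require Import structures.
From mathcomp Require Import all_boot all_order all_algebra.
From mathcomp Require Import ring zify.

(**
  Fix j and write p_i = q_{j,i}, s_i = q_{j+1,i}; let R be the geometric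
  R-matrix acting on these two families.

  Two elements are visibly the two-variable loop elementary symmetric
  functions: p_a + s_{a-1} and p_a s_a.  R fixes both (R_sum, R_mul).  Each
  kappa_a is a sum of words with one letter in each class S_k except one, so
  it commutes with p_a s_a up to the factor eps (ps_kappa), which gives the
  invariance of the product; the invariance of the sum amounts to the identity
  kappa_balance, both sides of which are expanded into words.

  A tableau is now cut up according to its entries j and j+1, called active.
  Replacing every j+1 by j (collapse) groups the tableaux into fibers, and it
  is enough to prove that the sum over each fiber is fixed by R.  Along a fiber
  only the columns with exactly one active entry vary: that entry, called lone,
  is j or j+1, and the sole constraint is that j+1 is not followed by j when
  two adjacent columns have their lone entries in the same row (refill_ssyt).
  So a fiber sum has the form
    sum_b prod_c X_c(b_c),
  b running over the 0/1 words which increase along certain links c -- c+1.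

  If c and c+1 are the last two columns and are linked, the forbidden words are
  those with b_c = 1, b_{c+1} = 0.  Since b_c = 1 puts no constraint on the
  earlier letters, deleting these words gives the recursion linked_sumSS
    Z_{c+2} = Z_{c+1} (X_{c+1}(0) + X_{c+1}(1)) - Z_c X_c(1) X_{c+1}(0),
  without the last term if there is no link.  It remains to see that R fixes
  the factors.  In X_c(0) + X_c(1) the varying entry contributes
  p_a + s_{a-1} between inert factors, and in X_c(1) X_{c+1}(0) the two entries
  have contents such that s_a and p_a meet, separated by generators which are
  fixed by R and commute with s_a up to a power of eps; so s_a can be moved next
  to p_a.  Finally a column with two active entries contains the product
  p_a s_a.
*)

Set Implicit Arguments.
Unset Strict Implicit.
Unset Printing Implicit Defensive.

Import GRing.Theory.

Local Open Scope ring_scope.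

(** * Commutation up to central factors *)

Section QCommutation.

Variable Q : unitRingType.
Implicit Types c d x y z : Q.

Lemma qcomm_mull c d x y z : (forall u, d * u = u * d) ->
  x * z = c * z * x -> y * z = d * z * y ->
  x * y * z = c * d * z * (x * y).
Proof.
move=> dC xz yz; rewrite -mulrA yz !mulrA -(dC x) -(mulrA d) xz !mulrA.
by rewrite (dC c).
Qed.

Lemma qcomm_mulr c d x y z : (forall u, d * u = u * d) ->
  z * x = c * x * z -> z * y = d * y * z ->
  z * (x * y) = c * d * (x * y) * z.
Proof.
move=> dC zx zy.
by rewrite mulrA zx -mulrA zy !mulrA -(mulrA c x) -(dC x) !mulrA.
Qed.

End QCommutation.

(** * Words in two consecutive families of generators *)

Lemma natZp_neq0 (n d : nat) : (0 < d < n)%N -> d%:R != 0 :> 'Z_n.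
Proof.
case/andP=> d0 dn; have n1 : (1 < n)%N by apply: leq_ltn_trans dn.
by rewrite -val_eqE /= val_Zp_nat // modn_small // -lt0n.
Qed.

Section Letters.

Variables (n m : nat) (Q : unitRingType) (eps : Q) (q : nat -> 'Z_n -> Q).
Hypotheses (n3 : (3 <= n)%N) (rel : torus_relations m eps q).

(** Generators only interact when their classes S_k are equal or adjacent; the
  class of q_{j,i} is determined by i + j. *)
Lemma gens_comm j i j' i' : (1 <= j <= m)%N -> (1 <= j' <= m)%N ->
    i + j%:R - (i' + j'%:R) \notin [:: 0; 1; -1] ->
  q j i * q j' i' = q j' i' * q j i.
Proof.
move=> hj hj'; rewrite !inE !negb_or => /and3P[d0 d1 dN1].
apply: (gen_comm rel) => //; apply/norP; split; apply/existsP=> -[k];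
  rewrite /in_S.
- case/andP=> /eqP e /eqP e'; case/eqP: d1; rewrite e e'; ring.
- case/and3P=> /eqP e /eqP e' _; case/eqP: d0; rewrite e e'; ring.
- case/andP=> /eqP e /eqP e'; case/eqP: dN1; rewrite e e'; ring.
- case/and3P=> /eqP e /eqP e' _; case/eqP: d0; rewrite e e'; ring.
Qed.

Lemma gens_qcomm j i j' i' : (1 <= j <= m)%N -> (1 <= j' <= m)%N ->
  exists z : int, q j i * q j' i' = eps ^ z * q j' i' * q j i.
Proof.
move=> hj hj'.
have [|] := boolP (i + j%:R - (i' + j'%:R) \in [:: 0; 1; -1]); last first.
  by move=> h; exists 0; rewrite expr0z mul1r gens_comm.
have S0 : in_S (i' + j'%:R - 1) j' i' by apply/eqP; ring.
rewrite !inE => /or3P[] /eqP e.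
- have S1 : in_S (i' + j'%:R - 1) j i.
    by apply/eqP; rewrite -[LHS](subrK (i' + j'%:R)) e; ring.
  have [lt|lt|eqj] := ltngtP j j'.
  + by exists (- 2%:Z); rewrite (gen_same_lt rel hj hj' S1 S0).
  + by exists 2%:Z; rewrite (gen_same_gt rel hj hj' S1 S0).
  exists 0; move: e; rewrite -eqj expr0z mul1r => /eqP.
  by rewrite subr_eq0 (inj_eq (addIr _)) => /eqP->.
- have S1 : in_S (i' + j'%:R - 1 + 1) j i.
    by apply/eqP; rewrite -[LHS](subrK (i' + j'%:R)) e; ring.
  have [le|lt] := leqP j j'.
  + by exists 1; rewrite (gen_succ_le rel hj hj' S1 S0).
  by exists (-1); rewrite (gen_succ_gt rel hj hj' S1 S0).
- have S1 : in_S (i + j%:R - 1) j i by apply/eqP; ring.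
  have S2 : in_S (i + j%:R - 1 + 1) j' i'.
    apply/eqP; rewrite -[i + _](subrK (i' + j'%:R)) e; ring.
  have E := eps_unit rel.
  have C y k : eps ^ k * y = y * eps ^ k.
    by apply/commr_sym/commrXz/commr_sym/(eps_central rel).
  have [le|lt] := leqP j' j.
  + exists (-1); rewrite -mulrA (gen_succ_le rel hj' hj S2 S1 le) -mulrA.
    by rewrite (mulrA (eps ^ _)) mulVr ?mul1r.
  exists 1; rewrite -mulrA (gen_succ_gt rel hj' hj S2 S1 lt) -mulrA.
  by rewrite (mulrA (eps ^ _)) mulrV ?mul1r.
Qed.

Variable j : nat.
Hypotheses (j1 : (1 <= j)%N) (jm : (j < m)%N).

Let hj : (1 <= j <= m)%N. Proof. by rewrite j1 ltnW. Qed.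

Local Notation p := (q j).
Local Notation s := (q j.+1).

(** [letter false a] and [letter true a] are the two generators among the p_i
  and s_i that lie in the same class S_k, k = a + j - 1; call a the level.  In
  kappa the level decreases by one from each factor to the next, whichever of
  the two families the factors come from. *)
Definition letter (t : bool) (a : 'Z_n) : Q := if t then s (a - 1) else p a.

Let level (t : bool) (a : 'Z_n) : letter t a = q (j + t) (a - t%:R).
Proof. by case: t; rewrite /letter ?addn1 ?addn0 ?subr0. Qed.

Let hjt (t : bool) : (1 <= j + t <= m)%N.
Proof. by case: t; rewrite ?addn1 ?addn0. Qed.

Lemma letter_comm t t' a b : a - b \notin [:: 0; 1; -1] ->
  letter t a * letter t' b = letter t' b * letter t a.
Proof.
move=> h; rewrite !level; apply: gens_comm => //.
by rewrite !natrD (_ : _ - _ = a - b) //; ring.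
Qed.

Lemma letter_succ (t t' : bool) a : (t <= t')%N ->
  letter t a * letter t' (a - 1) = eps * letter t' (a - 1) * letter t a.
Proof.
move=> tt'; rewrite !level.
apply: (gen_succ_le rel (k := a + j%:R - 2%:R)) => //.
- by rewrite /in_S natrD; apply/eqP; ring.
- by rewrite /in_S natrD; apply/eqP; ring.
- by rewrite leq_add2l.
Qed.

Lemma s_p a : s a * p a = eps^-1 * p a * s a.
Proof.
apply: (gen_succ_gt rel (k := a + j%:R - 1)) => //.
- by rewrite /in_S -natr1; apply/eqP; ring.
- by apply/eqP; ring.
Qed.

Lemma s_p_succ a : s a * p (a + 1) = eps ^+ 2 * p (a + 1) * s a.
Proof.
apply: (gen_same_gt rel (k := a + j%:R)) => //.
- by rewrite /in_S -natr1; apply/eqP; ring.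
- by apply/eqP; ring.
Qed.

Let epsC x : eps * x = x * eps. Proof. exact: (eps_central rel). Qed.
Let epsU := eps_unit rel.
Let epsVC x : eps^-1 * x = x * eps^-1.
Proof. by apply/commr_sym/commrV/commr_sym/epsC. Qed.

Section Words.

Variables (N : nat).
Hypothesis nE : n = N.+3.

Let n0 : N.+3%:R = 0 :> 'Z_n.
Proof. by rewrite -nE pchar_Zp // (leq_trans _ n3). Qed.

Let lt0 d : (0 < d < N.+3)%N -> d%:R != 0 :> 'Z_n.
Proof. by rewrite -nE; apply: natZp_neq0. Qed.

(** The word of length M whose levels are a - 1, a - 2, ..., a - M; the truth
  values t choose the family of each letter. *)
Definition word (t : nat -> bool) (a : 'Z_n) (M : nat) : Q :=
  \prod_(k < M) letter (t k) (a - 1 - k%:R).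

(** With n = N.+3, the word has one letter at each level except a and a + 1, so
  its first letter is the only one that interacts with a letter of level a; the
  order of the two families decides the exponent of eps. *)
Lemma letter_word (t' : bool) (t : nat -> bool) a : (t' <= t 0%N)%N ->
  letter t' a * word t a N.+1 = eps * word t a N.+1 * letter t' a.
Proof.
move=> le; rewrite /word big_ord_recl /= subr0 mulrA letter_succ // -!mulrA.
congr (_ * (_ * _)); apply: commr_prod => k _; apply: letter_comm.
have kN := ltn_ord k.
rewrite (_ : _ - _ = k.+2%:R) ?inE; last first.
  by rewrite /bump leq0n add1n -!natr1; ring.
rewrite !negb_or lt0 /=; last by lia.
apply/andP; split; rewrite -subr_eq0.
  by rewrite -natr1 addrK lt0 //; lia.
by rewrite opprK natr1 lt0 //; lia.
Qed.

(** Likewise s_a has level a + 1 and only interacts with the last letter, which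
  has level a + 2. *)
Lemma s_word t a : s a * word t a N.+1 = eps^-1 * word t a N.+1 * s a.
Proof.
have sE : s a = letter true (a + 1) by rewrite /letter addrK.
rewrite /word big_ord_recr /= -/(word t a N) mulrA sE.
have -> : letter true (a + 1) * word t a N = word t a N * letter true (a + 1).
  apply: commr_prod => k _; apply: letter_comm.
  have kN := ltn_ord k.
  rewrite (_ : _ - _ = k.+2%:R) ?inE; last by rewrite -!natr1; ring.
  rewrite !negb_or lt0 /=; last by lia.
  apply/andP; split; rewrite -subr_eq0.
    by rewrite -natr1 addrK lt0 //; lia.
  by rewrite opprK natr1 lt0 //; lia.
have -> : a - 1 - N%:R = a + 2%:R.
  by rewrite -[RHS]subr0 -n0 -!natr1; ring.
have := @letter_succ (t N) true (a + 2%:R) (leq_b1 _).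
have -> : a + 2%:R - 1 = a + 1 by ring.
move=> e; rewrite -!mulrA e !mulrA -(epsC (_^-1 * _)) !mulrA.
by rewrite mulrV // mul1r.
Qed.

(** The factors produced by p_a at the beginning of the word and by s_a at its
  end cancel. *)
Lemma ps_word t a : p a * s a * word t a N.+1 = word t a N.+1 * (p a * s a).
Proof.
rewrite -[in RHS](mul1r (word _ _ _)) -(divrr epsU).
apply: qcomm_mull; [exact: epsVC| | exact: s_word].
exact: (@letter_word false).
Qed.

Lemma sp_word t a : s a * p a * word t a N.+1 = word t a N.+1 * (s a * p a).
Proof.
rewrite -[in RHS](mul1r (word _ _ _)) -(mulVr epsU).
apply: qcomm_mull; [exact: epsC | exact: s_word |].
exact: (@letter_word false).
Qed.

(** The h-th summand of kappa_a is the word whose first h letters come from the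
  p_i and the others from the s_i. *)
Lemma kappaE a : kappa p s a = \sum_(h < N.+3) word (leq h) a N.+2.
Proof.
rewrite -(big_mkord xpredT (fun h => word (leq h) a N.+2)) -nE /kappa.
apply: eq_big_nat => h /andP[_ hn]; rewrite /word.
rewrite -(big_mkord xpredT (fun k => letter (h <= k)%N (a - 1 - k%:R))).
rewrite [RHS](@big_cat_nat _ _ _ h) //=; last by rewrite -ltnS -nE.
rewrite !big_add1 /= (_ : n.-1 = N.+2); last by lia.
congr (_ * _); apply: eq_big_nat => k /andP[k1 k2]; rewrite /letter.
  by rewrite leqNgt k2 /=; congr p; rewrite -natr1; ring.
by rewrite k1; congr s; rewrite -!natr1; ring.
Qed.

(** The following three lemmas split off an end of a word; in the first and the
  third the level of the last letter is computed modulo n. *)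
Lemma word_recr t a : word t a N.+2 = word t a N.+1 * letter (t N.+1) (a + 1).
Proof.
rewrite /word big_ord_recr /=; congr (_ * letter _ _).
by rewrite -[RHS]subr0 -n0 -!natr1; ring.
Qed.

Lemma word_recl t a M :
  word t (a + 1) M.+1 = letter (t 0%N) a * word (fun k => t k.+1) a M.
Proof.
rewrite /word big_ord_recl /= addrK subr0; congr (_ * _).
by apply: eq_bigr => k _; congr letter; rewrite /bump leq0n add1n -natr1; ring.
Qed.

Lemma word_recr_cycle t a : word t a N.+3 = word t a N.+2 * letter (t N.+2) a.
Proof.
rewrite /word big_ord_recr /=; congr (_ * letter _ _).
by rewrite -[RHS]subr0 -n0 -!natr1; ring.
Qed.

Lemma ps_letter t a :
  p a * s a * letter t (a + 1) = eps * letter t (a + 1) * (p a * s a).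
Proof.
have ps : p a * s a = eps * s a * p a by rewrite -mulrA s_p !mulrA mulrV ?mul1r.
case: t; rewrite /letter ?addrK.
  by rewrite -[in RHS](mulr1 eps); apply: qcomm_mull => // [u|];
    rewrite mul1r ?mulr1.
have <- : eps^-1 * eps ^+ 2 = eps by rewrite expr2 mulKr.
apply: qcomm_mull (s_p_succ _).
  by move=> u; apply/commr_sym/commrX/commr_sym/epsC.
have := letter_succ (a + 1) (leqnn false); rewrite /letter addrK => e.
by rewrite -mulrA e !mulrA mulVr ?mul1r.
Qed.

Lemma ps_kappa a :
  p a * s a * kappa p s a = eps * kappa p s a * (p a * s a).
Proof.
rewrite kappaE mulr_sumr mulr_sumr mulr_suml; apply: eq_bigr => h _.
rewrite word_recr -[in RHS](mul1r eps).
apply: qcomm_mulr => //; first by rewrite mul1r ps_word.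
exact: ps_letter.
Qed.

(** A word in the s_i of length n, one letter for each level, may be rotated by
  two places. *)
Lemma s_words a : s a * word (leq 0) (a + 1) N.+2 = word (leq 0) a N.+3.
Proof.
rewrite word_recr_cycle [in RHS]word_recr word_recl.
have -> : word (fun k => leq 0 k.+1) a N.+1 = word (leq 0) a N.+1 by [].
rewrite /letter addrK mulrA.
rewrite (@qcomm_mull _ eps^-1 eps) ?mulVr ?mul1r ?mulrA //; first exact: s_word.
exact: (@letter_word true).
Qed.

(** All four products are sums of words of length n, of which all but a few
  appear on both sides: p_{a-1} kappa_{a-1} and kappa_a s_{a-1} are the sums of
  the words with levels a - 1, ..., a - n, except for the all-s word in the
  first and the all-p word in the second.  In the two other products the
  remaining word, of length n - 2, commutes with s_a p_a. *)
Lemma kappa_balance a :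
  s a * kappa p s (a + 1) + p (a - 1) * kappa p s (a - 1) =
  kappa p s a * (p a + s (a - 1)).
Proof.
have pk : p (a - 1) * kappa p s (a - 1) =
    \sum_(h < N.+3) word (leq h.+1) a N.+3.
  rewrite kappaE mulr_sumr; apply: eq_bigr => h _.
  by rewrite -[in RHS](subrK 1 a) word_recl.
have ks : kappa p s a * s (a - 1) = \sum_(h < N.+3) word (leq h) a N.+3.
  rewrite kappaE mulr_suml; apply: eq_bigr => h _.
  by rewrite word_recr_cycle -[(h <= _)%N]ltnS ltn_ord.
have kp : kappa p s a * p a =
    \sum_(h < N.+2) word (leq h) a N.+1 * (s a * p a) + word (leq N.+3) a N.+3.
  rewrite kappaE mulr_suml big_ord_recr /=; congr (_ + _).
    apply: eq_bigr => h _; rewrite word_recr -[(h <= _)%N]ltnS ltn_ord.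
    by rewrite /letter addrK mulrA.
  rewrite word_recr_cycle ltnn; congr (_ * _); apply: eq_bigr => k _.
  by have kN := ltn_ord k; congr letter; lia.
have sk : s a * kappa p s (a + 1) =
    word (leq 0) a N.+3 + \sum_(h < N.+2) word (leq h) a N.+1 * (s a * p a).
  rewrite kappaE mulr_sumr big_ord_recl s_words; congr (_ + _).
  by apply: eq_bigr => h _; rewrite word_recl mulrA sp_word.
rewrite mulrDr pk ks kp sk; set S := \sum_(h < N.+2) _.
rewrite [in LHS]big_ord_recr [in RHS]big_ord_recl /=.
by rewrite [word _ _ _ + S]addrC [X in _ + X = _]addrC addrACA.
Qed.

End Words.

(** Both terms of the image share the left factor of kappa_a inverse, and
  [kappa_balance] says what is left. *)
Lemma R_sum (R : {rmorphism Q -> Q}) (geom : is_geometric_R m eps q j R)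
    (kU : forall a, kappa p s a \is a GRing.unit) a :
  R (p a + s (a - 1)) = p a + s (a - 1).
Proof.
have [N nE] : exists N, n = N.+3 by exists (n - 3)%N; lia.
rewrite rmorphD (geomR_p geom) (geomR_q geom) subrK -!mulrA -mulrDr.
by rewrite (kappa_balance nE) mulKr.
Qed.

(** The image is the conjugate of s_a p_a by kappa_a; the factors eps^-1 from
  reordering s_a p_a and eps from [ps_kappa] cancel. *)
Lemma R_mul (R : {rmorphism Q -> Q}) (geom : is_geometric_R m eps q j R)
    (kU : forall a, kappa p s a \is a GRing.unit) a :
  R (p a * s a) = p a * s a.
Proof.
have [N nE] : exists N, n = N.+3 by exists (n - 3)%N; lia.
rewrite rmorphM (geomR_p geom) (geomR_q geom) !mulrA mulrK // -(mulrA _ (s a)).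
by rewrite s_p // -!mulrA (mulrA (p a)) (ps_kappa nE) -!mulrA !mulKr.
Qed.

End Letters.

(** * Sums over 0/1 words increasing along links *)

Section Transfer.

Lemma sum_tuple_rcons (V : nmodType) k (P : pred (seq bool))
    (F : seq bool -> V) :
  \sum_(b : k.+1.-tuple bool | P b) F b =
  \sum_(b : k.-tuple bool) \sum_(x : bool | P (rcons b x)) F (rcons b x).
Proof.
rewrite big_mkcond; under [RHS]eq_bigr do rewrite big_mkcond.
rewrite pair_big /=.
pose f (y : k.-tuple bool * bool) := [tuple of rcons y.1 y.2].
rewrite (reindex f) //=; apply/onW_bij/inj_card_bij.
  move=> [b x] [b' x'] /(congr1 val) /= /rcons_inj[e ->].
  by congr pair; apply: val_inj.
by rewrite card_prod !card_tuple card_bool expnSr.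
Qed.

Variable lk : nat -> bool.

(** [lk c] says that positions c and c + 1 are linked. *)
Definition increasing_on_links (t : seq bool) : bool :=
  all (fun c => lk c && nth false t c ==> nth false t c.+1)
    (iota 0 (size t).-1).

Local Notation ok := increasing_on_links.

Lemma increasing_rcons2 t x y :
  ok (rcons (rcons t x) y) = ok (rcons t x) && (lk (size t) && x ==> y).
Proof.
rewrite /ok !size_rcons !succnK -[(size t).+1]addn1 iotaD all_cat /= andbT.
congr andb.
  apply: eq_in_all => c; rewrite mem_iota add0n /= => ct.
  by rewrite ![nth _ (rcons (rcons _ _) _) _]nth_rcons size_rcons !ltnS ct ltnW.
by rewrite add0n !nth_rcons size_rcons ltnSn !ltnn !eqxx.
Qed.

(** A final 1 is compatible with every earlier letter; this is what makes the
  recursion for [linked_sum] close up after two steps. *)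
Lemma increasing_rcons_true t : ok (rcons t true) = ok t.
Proof.
by case: t / (lastP t) => // t x; rewrite increasing_rcons2 implybT andbT.
Qed.

Variables (Q : pzRingType) (X : nat -> bool -> Q).

Definition linked_sum (k : nat) : Q :=
  \sum_(b : k.-tuple bool | ok b) \prod_(c < k) X c (nth false b c).

Lemma prod_rcons k (b : k.-tuple bool) x :
  \prod_(c < k.+1) X c (nth false (rcons b x) c) =
  \prod_(c < k) X c (nth false b c) * X k x.
Proof.
rewrite big_ord_recr /= nth_rcons size_tuple ltnn eqxx; congr (_ * _).
by apply: eq_bigr => c _; rewrite nth_rcons size_tuple ltn_ord.
Qed.

Lemma linked_sum0 : linked_sum 0 = 1.
Proof.
rewrite /linked_sum (big_pred1 [tuple]) ?big_ord0 // => b.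
by rewrite [b]tuple0.
Qed.

Lemma linked_sum1 : linked_sum 1 = X 0 false + X 0 true.
Proof.
pose F (b : seq bool) := \prod_(c < 1) X c (nth false b c).
rewrite /linked_sum (sum_tuple_rcons _ _ F).
rewrite (big_pred1 [tuple]) => [|b]; last first.
  by apply/esym/eqP; rewrite [LHS]tuple0.
by rewrite [LHS]big_bool /F !big_ord1 /= addrC.
Qed.

(** Inclusion-exclusion on the last link: all words that are increasing up to
  position k, minus those that end in 1, 0. *)
Lemma linked_sumSS k :
  linked_sum k.+2 = linked_sum k.+1 * (X k.+1 false + X k.+1 true) -
    if lk k then linked_sum k * (X k true * X k.+1 false) else 0.
Proof.
pose F l b := \prod_(c < l) X c (nth false b c).
have skip : (if lk k then linked_sum k * (X k true * X k.+1 false) else 0) =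
    \sum_(b : k.-tuple bool) if lk k && ok b
      then F k b * (X k true * X k.+1 false) else 0.
  case: (lk k); last by rewrite big1.
  by rewrite /linked_sum mulr_suml [LHS]big_mkcond.
rewrite skip /linked_sum (sum_tuple_rcons _ _ (F k.+2)) big_mkcond /=.
rewrite (sum_tuple_rcons _ _ (F k.+1)) mulr_suml -sumrB.
pose G (t : seq bool) := \sum_(y | ok (rcons t y)) F k.+2 (rcons t y).
rewrite (sum_tuple_rcons _ xpredT G); apply: eq_bigr => b _.
have sumG x : G (rcons b x) = if ok (rcons b x) then F k b * X k x *
    (X k.+1 true + if lk k && x then 0 else X k.+1 false) else 0.
  rewrite /G [LHS]big_mkcond big_bool !increasing_rcons2 size_tuple.
  rewrite implybT andbT.
  have FE y : F k.+2 (rcons (rcons b x) y) = F k b * X k x * X k.+1 y.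
    by rewrite -prod_rcons -[RHS](@prod_rcons _ [tuple of rcons b x]).
  case: (ok _) => /=; last by rewrite addr0.
  by rewrite implybF !FE mulrDr; case: (lk k && x); rewrite ?mulr0.
rewrite big_mkcond [X in _ = X * _ - _]big_mkcond !big_bool !sumG.
rewrite !increasing_rcons_true.
rewrite /F !prod_rcons andbT andbF mulrDl addrAC; congr (_ + _).
  case: (ok b); last by rewrite andbF mul0r subr0.
  case: (lk k) => /=; last by rewrite subr0 [X in _ * X]addrC.
  by rewrite mulrA addr0 mulrDr addrAC subrr add0r.
by case: (ok _); rewrite ?mul0r // [X in _ * X]addrC.
Qed.

Lemma linked_sum_fixed (R : {rmorphism Q -> Q}) :
    (forall c, R (X c false + X c true) = X c false + X c true) ->
    (forall c, lk c -> R (X c true * X c.+1 false) = X c true * X c.+1 false) ->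
  forall k, R (linked_sum k) = linked_sum k.
Proof.
move=> Rsum Rskip k.
suff [] : R (linked_sum k) = linked_sum k /\
          R (linked_sum k.+1) = linked_sum k.+1 by [].
elim: k => [|k [IH0 IH1]].
  by rewrite linked_sum0 rmorph1 linked_sum1 Rsum.
split=> //; rewrite linked_sumSS rmorphB rmorphM /= IH1 Rsum; congr (_ - _).
by case: ifP => [l|_]; rewrite ?rmorph0 // rmorphM IH0 /= Rskip.
Qed.

End Transfer.

(** * Semistandard tableaux with the same collapse *)

Section Tableaux.

Lemma partition_nth_le (l : seq nat) i i' : is_partition l -> (i <= i')%N ->
  (nth 0 l i' <= nth 0 l i)%N.
Proof.
move=> pl ii'; have [i'l|] := ltnP i' (size l); last first.
  by move=> ?; rewrite nth_default.
have geq_trans : transitive geq by move=> x y z /= ? ?; lia.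
by apply: (sorted_leq_nth geq_trans leqnn 0%N pl) => //; rewrite inE; lia.
Qed.

Variables (lam mu : seq nat).
Hypothesis shape : is_skew_shape lam mu.

Local Notation inside := (in_skew lam mu).

Lemma in_skew_convex i1 i2 i3 c1 c2 c3 :
    (i1 <= i2 <= i3)%N -> (c1 <= c2 <= c3)%N ->
  inside i1 c1 -> inside i3 c3 -> inside i2 c2.
Proof.
case: shape => pl pm _ /andP[i12 i23] cc; rewrite /in_skew.
have := partition_nth_le pl i23; have := partition_nth_le pm i12; lia.
Qed.

Variable m : nat.

Local Notation row := 'I_(size lam).
Local Notation col := 'I_(head 0%N lam).
Implicit Types (T : filling m lam) (i : row) (c : col).

Lemma ssytP T : reflect
  [/\ forall i c, (0 < T (i, c))%N = inside i c,
      forall i c c', inside i c -> inside i c' -> (c <= c')%N ->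
        (T (i, c) <= T (i, c'))%N
    & forall i i' c, inside i c -> inside i' c -> (i < i')%N ->
        (T (i, c) < T (i', c))%N]
  (T \in ssyt m lam mu).
Proof.
rewrite inE; apply: (iffP and3P) => -[supp rows cols]; split.
- move=> i c; move/forallP: supp => /(_ i)/forallP/(_ c).
  by case: ifP => // _ /eqP->.
- move=> i c c' ic ic'; rewrite leq_eqVlt => /orP[/eqP/val_inj-> //|cc'].
  move/forallP: rows => /(_ i)/forallP/(_ c)/forallP/(_ c')/implyP; apply.
  by rewrite ic ic'.
- move=> i i' c ic i'c ii'.
  move/forallP: cols => /(_ i)/forallP/(_ i')/forallP/(_ c)/implyP; apply.
  by rewrite ic i'c.
- apply/forallP=> i; apply/forallP=> c; rewrite -supp; case: ifP => // /negbT.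
  by rewrite -leqNgt leqn0.
- apply/forallP=> i; apply/forallP=> c; apply/forallP=> c'.
  by apply/implyP=> /and3P[ic ic' cc']; apply: rows => //; apply: ltnW.
- apply/forallP=> i; apply/forallP=> i'; apply/forallP=> c.
  by apply/implyP=> /and3P[ic i'c ii']; apply: cols.
Qed.

Variable j : nat.

Definition active (v : nat) : bool := (j <= v <= j.+1)%N.

Lemma active_lt v w : active v -> active w -> (v < w)%N -> v = j /\ w = j.+1.
Proof. by rewrite /active => av aw vw; split; lia. Qed.

Hypotheses (j1 : (1 <= j)%N) (jm : (j < m)%N).

Definition ord_j : 'I_m.+1 := Ordinal (ltnW jm : (j < m.+1)%N).
Definition ord_j1 : 'I_m.+1 := Ordinal (jm : (j.+1 < m.+1)%N).

Definition collapse T : filling m lam :=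
  [ffun x => if active (T x) then ord_j else T x].

(** The box (i, c) carries the only active entry of its column. *)
Definition lone T i c : bool :=
  [forall i' : row, active (T (i', c)) == (i' == i)].

Lemma loneP T i c : reflect
  (active (T (i, c)) /\ forall i', active (T (i', c)) -> i' = i) (lone T i c).
Proof.
apply: (iffP forallP) => [l|[ai ui] i'].
  split=> [|i' ai']; first by rewrite (eqP (l i)).
  by apply/eqP; rewrite -(eqP (l i')).
by case: (i' =P i) => [->|ne]; [rewrite ai | apply/eqP/negP=> /ui].
Qed.

Definition has_lone T c : bool := [exists i, lone T i c].

(** The tableau of the fiber of T whose lone entries are prescribed by b.  A
  column without a lone entry is copied from T: two active entries in a column
  are forced to be j above j + 1. *)
Definition refill T (b : seq bool) : filling m lam :=
  [ffun x => if lone T x.1 x.2 then (if nth false b x.2 then ord_j1 else ord_j)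
             else T x].

Definition bits T T' : (head 0%N lam).-tuple bool :=
  [tuple [exists i, lone T i c && (T' (i, c) == ord_j1)] | c < head 0%N lam].

Definition linked T (k : nat) : bool :=
  [exists i : row, exists c : col, exists c' : col,
    [&& c == k :> nat, c' == k.+1 :> nat, lone T i c & lone T i c']].

Section Fiber.

Variable T : filling m lam.
Hypothesis hT : T \in ssyt m lam mu.

Let supp i c : (0 < T (i, c))%N = inside i c.
Proof. by case/ssytP: hT. Qed.
Let rows i c c' : inside i c -> inside i c' -> (c <= c')%N ->
  (T (i, c) <= T (i, c'))%N.
Proof. by case/ssytP: hT => _ h _; apply: h. Qed.
Let cols i i' c : inside i c -> inside i' c -> (i < i')%N ->
  (T (i, c) < T (i', c))%N.
Proof. by case/ssytP: hT => _ _; apply. Qed.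

Lemma active_inside i c : active (T (i, c)) -> inside i c.
Proof. by rewrite -supp => /andP[/(leq_trans j1)]. Qed.

(** The box in row i' of the column of the lone entry would belong to the shape,
  and its entry would lie strictly above j and weakly below j + 1, hence be a
  second active entry of that column.  [lone_no_above] is symmetric. *)
Lemma lone_no_below i i' c c' : lone T i c -> active (T (i', c')) ->
  (i < i')%N -> (c <= c')%N -> False.
Proof.
move=> /loneP[a u] a' ii' cc'.
have s := active_inside a; have s' := active_inside a'.
have s2 : inside i' c by apply: in_skew_convex s s'; lia.
suff /u e : active (T (i', c)) by rewrite e ltnn in ii'.
have := cols s s2 ii'; have := rows s2 s' cc'; move: a a'; rewrite /active; lia.
Qed.

Lemma lone_no_above i i' c c' : lone T i c' -> active (T (i', c)) ->
  (i' < i)%N -> (c <= c')%N -> False.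
Proof.
move=> /loneP[a u] a' ii' cc'.
have s := active_inside a; have s' := active_inside a'.
have s2 : inside i' c' by apply: in_skew_convex s' s; lia.
suff /u e : active (T (i', c')) by rewrite e ltnn in ii'.
have := cols s2 s ii'; have := rows s' s2 cc'; move: a a'; rewrite /active; lia.
Qed.

Lemma lone_between i c1 c2 c3 : (c1 <= c2 <= c3)%N ->
  lone T i c1 -> lone T i c3 -> lone T i c2.
Proof.
move=> /andP[c12 c23] l1 l3; have /loneP[a1 _] := l1; have /loneP[a3 _] := l3.
have s1 := active_inside a1; have s3 := active_inside a3.
have s2 : inside i c2 by apply: in_skew_convex s1 s3; lia.
apply/loneP; split.
  have := rows s1 s2 c12; have := rows s2 s3 c23.
  by move: a1 a3; rewrite /active; lia.
move=> i' a'; apply: val_inj; have [lt|lt|//] := ltngtP i' i.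
  by case: (lone_no_above l3 a' lt c23).
by case: (lone_no_below l1 a' lt c12).
Qed.

Lemma refill_lone b i c : lone T i c ->
  refill T b (i, c) = if nth false b c then ord_j1 else ord_j.
Proof. by rewrite ffunE /= => ->. Qed.

Lemma refill_other b i c : ~~ lone T i c -> refill T b (i, c) = T (i, c).
Proof. by rewrite ffunE /= => /negbTE->. Qed.

Lemma active_refill b x : active (refill T b x) = active (T x).
Proof.
case: x => i c; rewrite ffunE; case: ifP => // /loneP[-> _].
by rewrite /active; case: ifP => _ /=; rewrite !leqnn ?leqnSn.
Qed.

Lemma collapse_refill b : collapse (refill T b) = collapse T.
Proof.
apply/ffunP=> -[i c]; rewrite [LHS]ffunE [RHS]ffunE active_refill.
case: ifP => // na; rewrite refill_other //.
by apply/negP=> /loneP[]; rewrite na.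
Qed.

(** By [lone_between], a chain of links joins two lone entries of a row. *)
Lemma links_monotone (b : (head 0%N lam).-tuple bool) i c c' :
    increasing_on_links (linked T) b ->
  lone T i c -> lone T i c' -> (c <= c')%N -> nth false b c -> nth false b c'.
Proof.
move=> ok l; have [d] := ubnP (c' - c)%N; elim: d c' => // d IH c' dc l' cc' bc.
have [e|lt] := eqVneq (c : nat) c'; first by rewrite -e.
have c'' : (c'.-1 < head 0 lam)%N by have := ltn_ord c'; lia.
pose e := Ordinal c''.
have le : lone T i e by apply: (lone_between _ l l') => /=; lia.
have be : nth false b e by apply: IH => //=; lia.
have sb : (c'.-1 < (size b).-1)%N.
  by rewrite size_tuple; have := ltn_ord c'; lia.
move/allP: ok => /(_ c'.-1); rewrite mem_iota /= => /(_ sb); rewrite be andbT.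
rewrite prednK; last by lia.
move/implyP; apply; apply/existsP; exists i; apply/existsP; exists e.
by apply/existsP; exists c'; rewrite /= eqxx prednK ?eqxx ?le //; lia.
Qed.

(** In a row, comparing a lone entry with a non-lone active entry never depends
  on b: by [lone_no_below] and [lone_no_above] a non-lone active entry to the
  right of a lone one is the lower of two, so j + 1, and one to the left is the
  upper of two, so j. *)
Lemma refill_ssyt (b : (head 0%N lam).-tuple bool) :
  (refill T b \in ssyt m lam mu) = increasing_on_links (linked T) b.
Proof.
have lone_val i c : lone T i c ->
    refill T b (i, c) = (j + nth false b c)%N :> nat.
  by move=> /(refill_lone b)->; case: ifP => _ /=; rewrite ?addn0 ?addn1.
apply/idP/idP => [|ok].
  case/ssytP=> _ rows' _; apply/allP=> k; rewrite mem_iota size_tuple add0n /=.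
  move=> _; apply/implyP=> /andP[/existsP[i /existsP[c /existsP[c']]]].
  case/and4P=> /eqP<- /eqP e lc lc' bc.
  have /loneP[/active_inside sc _] := lc.
  have /loneP[/active_inside sc' _] := lc'.
  have cc' : (c <= c')%N by rewrite e.
  have := rows' _ _ _ sc sc' cc'; rewrite -e !lone_val // bc.
  by case: (nth false b c') => //=; lia.
apply/ssytP; split.
- move=> i c; have [l|nl] := boolP (lone T i c); last by rewrite refill_other.
  have /loneP[/active_inside-> _] := l; rewrite lone_val //; lia.
- move=> i c c' sc sc' cc'; have le := rows sc sc' cc'.
  have [l|nl] := boolP (lone T i c); have [l'|nl'] := boolP (lone T i c').
  + rewrite !lone_val // leq_add2l.
    have := links_monotone ok l l' cc'.
    by do 2!case: nth => //; move=> /(_ isT).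
  + rewrite lone_val // refill_other //.
    have /loneP[a _] := l.
    have [gt|ngt] := ltnP j (T (i, c')).
      by apply: leq_trans gt; rewrite -addn1 leq_add2l leq_b1.
    have a' : active (T (i, c')) by move: a; rewrite /active; lia.
    case/negP: nl'; apply/loneP; split=> // i' ai'.
    apply: val_inj; have [lt|lt|//] := ltngtP i' i.
      have := cols (active_inside ai') sc' lt; move: ai'; rewrite /active; lia.
    by case: (lone_no_below l ai' lt cc').
  + rewrite (lone_val _ _ l') refill_other //.
    have /loneP[a' _] := l'.
    have [lt|gt] := leqP (T (i, c)) j.
      by apply: leq_trans lt _; rewrite leq_addr.
    have a : active (T (i, c)) by move: a'; rewrite /active; lia.
    case/negP: nl; apply/loneP; split=> // i' ai'.
    apply: val_inj; have [ltt|ltt|//] := ltngtP i' i.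
      by case: (lone_no_above l' ai' ltt cc').
    have := cols sc (active_inside ai') ltt; move: ai'; rewrite /active; lia.
  + by rewrite !refill_other.
- move=> i i' c sc sc' ii'; have lt := cols sc sc' ii'.
  have [l|nl] := boolP (lone T i c); have [l'|nl'] := boolP (lone T i' c).
  + by have /loneP[_ u] := l; have /loneP[/u e _] := l'; rewrite e ltnn in ii'.
  + rewrite lone_val // refill_other //; have /loneP[a u] := l.
    have na : ~ active (T (i', c)) by move=> /u e; rewrite e ltnn in ii'.
    by move: na a; rewrite /active; case: nth; lia.
  + rewrite (lone_val _ _ l') refill_other //; have /loneP[a u] := l'.
    have na : ~ active (T (i, c)) by move=> /u e; rewrite e ltnn in ii'.
    by move: na a; rewrite /active; case: nth; lia.
  + by rewrite !refill_other.
Qed.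

Lemma bits_refill (b : (head 0%N lam).-tuple bool) :
  (bits T (refill T b) == b) = [forall c : col, nth false b c ==> has_lone T c].
Proof.
apply/eqP/forallP=> [<- c|h].
  rewrite -tnth_nth tnth_mktuple; apply/implyP=> /existsP[i /andP[l _]].
  by apply/existsP; exists i.
apply: eq_from_tnth => c; rewrite tnth_mktuple (tnth_nth false).
apply/existsP/idP => [[i /andP[l]]|bc].
  by rewrite refill_lone //; case: ifP => // _; rewrite -val_eqE /= ltn_eqF.
have /implyP/(_ bc)/existsP[i l] := h c.
by exists i; rewrite l refill_lone // bc /=.
Qed.

Lemma refill_bits (T' : filling m lam) :
    T' \in ssyt m lam mu -> collapse T' = collapse T ->
  refill T (bits T T') = T'.
Proof.
move=> hT' eT; have aT (x : row * col) : active (T' x) = active (T x).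
  move/ffunP: eT => /(_ x); rewrite !ffunE.
  have aj : active ord_j by rewrite /active /= leqnn leqnSn.
  by case: ifP => a'; case: ifP => a // e; rewrite -?e ?aj // e aj in a a' *.
suff eqx (i : row) (c : col) : refill T (bits T T') (i, c) = T' (i, c).
  by apply/ffunP=> -[i c]; apply: eqx.
have [l|nl] := boolP (lone T i c).
  rewrite refill_lone // -tnth_nth tnth_mktuple.
  have -> : [exists i', lone T i' c && (T' (i', c) == ord_j1)] =
            (T' (i, c) == ord_j1).
    apply/existsP/idP => [[i' /andP[/loneP[a' _] /eqP e]]|e]; last first.
      by exists i; rewrite l.
    by have /loneP[_ u] := l; rewrite -(u _ a') e.
  case: eqP => [->//|ne]; apply: val_inj => /=.
  have /loneP[] := l; rewrite -aT /active => a _.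
  have /eqP ne' : T' (i, c) <> j.+1 :> nat.
    by move=> e; apply: ne; apply: val_inj.
  case/andP: a => a1 a2; apply/eqP.
  by rewrite eqn_leq a1 -ltnS ltn_neqAle ne' a2.
rewrite refill_other //; have [a|na] := boolP (active (T (i, c))); last first.
  by move/ffunP: eT => /(_ (i, c)); rewrite !ffunE aT (negbTE na).
have s := active_inside a; have a' := a; rewrite -aT in a'.
have /existsP[i' /andP[ai' ne]] : [exists i', active (T (i', c)) && (i' != i)].
  apply: contraR nl => /existsPn h; apply/loneP; split=> // i' ai'.
  by apply/eqP; have := h i'; rewrite ai' /= negbK.
have s' := active_inside ai'; have ai'' := ai'; rewrite -aT in ai''.
have /ssytP[_ _ cols'] := hT'.
suff: T (i, c) = T' (i, c) :> nat by exact: val_inj.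
have [lt|lt|/val_inj e] := ltngtP i' i.
- have [_ ->] := active_lt ai' a (cols s' s lt).
  by have [_ ->] := active_lt ai'' a' (cols' _ _ _ s' s lt).
- have [-> _] := active_lt a ai' (cols s s' lt).
  by have [-> _] := active_lt a' ai'' (cols' _ _ _ s s' lt).
- by rewrite e eqxx in ne.
Qed.

End Fiber.

(** The entry of the refilled tableau, in terms of the letter x attached to the
  column. *)
Definition entry T (x : bool) i c : nat :=
  if lone T i c then (if x then j.+1 else j) else T (i, c).

Section Weights.

Variables (n : nat) (Q : unitRingType) (q : nat -> 'Z_n -> Q) (r : 'Z_n).

Definition box_weight (k : nat) i c : Q :=
  q k (i%:R - c%:R - k%:R + r + 1).

Definition column_weight T (x : bool) c : Q :=
  \prod_(i < size lam | inside i c) box_weight (entry T x i c) i c.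

(** A column without a lone entry has no choice to make; giving it weight 0 for
  the letter 1 turns the fiber sum into a sum over all words that increase on
  links.  The columns are numbered by all of nat, hence the default value. *)
Definition column_choice T (k : nat) (x : bool) : Q :=
  if insub k is Some c then
    if x && ~~ has_lone T c then 0 else column_weight T x c
  else if x then 0 else 1.

Lemma fiber_sum T : T \in ssyt m lam mu ->
  \sum_(T' in ssyt m lam mu | collapse T' == collapse T) tab_weight q mu r T' =
  linked_sum (linked T) (column_choice T) (head 0%N lam).
Proof.
move=> hT.
rewrite (reindex_onto (fun b : (head 0%N lam).-tuple bool => refill T b)
    (bits T)) /=; last first.
  by move=> T' /andP[hT' /eqP eT]; apply: refill_bits.
under eq_bigl do
  rewrite collapse_refill // eqxx andbT refill_ssyt // bits_refill //.
rewrite /linked_sum big_mkcondr /=; apply: eq_bigr => b _.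
case: ifP => [/forallP bT|/negbT].
  apply: eq_bigr => c _; rewrite /column_choice valK.
  have -> : nth false b c && ~~ has_lone T c = false.
    by apply/negbTE; rewrite negb_and negbK -implybE.
  apply: eq_bigr => i _; rewrite /box_weight.
  suff -> : refill T b (i, c) = entry T (nth false b c) i c :> nat by [].
  by rewrite /entry ffunE /=; case: ifP => // _; case: ifP.
rewrite negb_forall => /existsP[c]; rewrite negb_imply => bc.
apply/esym; move: (mem_index_enum c); elim: (index_enum _) => // d s IH.
rewrite inE big_cons => /orP[/eqP<-|/IH->]; last by rewrite mulr0.
by rewrite /column_choice valK bc mul0r.
Qed.

End Weights.
End Tableaux.

(** * Invariance of the column sums *)

Lemma prod_ord_split (Q : pzRingType) N (P : pred 'I_N) (F : 'I_N -> Q) i0 :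
  P i0 -> \prod_(i < N | P i) F i =
    \prod_(i < N | P i && (i < i0)%N) F i *
    (F i0 * \prod_(i < N | P i && (i0 < i)%N) F i).
Proof.
elim: N => [|N IH] in P F i0 *; first by case: i0.
move=> Pi0; rewrite big_mkcond [X in _ = X * _]big_mkcond.
rewrite [X in _ = _ * (_ * X)]big_mkcond !big_ord_recl /=.
case: (unliftP ord0 i0) Pi0 => [i1|] -> Pi1.
  rewrite ltn0 andbF mul1r lift0 ltnS leq0n andbT -!mulrA -!big_mkcond.
  congr (_ * _).
  by rewrite (IH (fun i => P (lift ord0 i)) (fun i => F (lift ord0 i)) i1) //.
rewrite Pi1 ltnn andbF !mul1r [X in _ = X * _]big1 ?mul1r => [|i _]; last first.
  by rewrite ltn0 andbF.
congr (_ * _); apply: eq_bigr => i _; by rewrite /bump leq0n add1n andbT.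
Qed.

Section ColumnSums.

Variables (n m : nat) (Q : unitRingType) (eps : Q) (q : nat -> 'Z_n -> Q).
Hypotheses (n3 : (3 <= n)%N) (rel : torus_relations m eps q).
Variables (j : nat) (R : {rmorphism Q -> Q}).
Hypotheses (j1 : (1 <= j)%N) (jm : (j < m)%N).
Hypotheses (geom : is_geometric_R m eps q j R).
Hypotheses (kU : forall a, kappa (q j) (q j.+1) a \is a GRing.unit).

(** The property of the factors that surround active entries: R fixes them, and
  they can be moved past y at the cost of a central factor that R also fixes. *)
Definition inert (y g : Q) : Prop :=
  R g = g /\
  exists c, [/\ R c = c, forall u, c * u = u * c & y * g = c * g * y].

Lemma inertM y g g' : inert y g -> inert y g' -> inert y (g * g').
Proof.
move=> [Rg [c [Rc Cc yg]]] [Rg' [c' [Rc' Cc' yg']]]; split.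
  by rewrite rmorphM /= Rg Rg'.
exists (c * c'); split; first by rewrite rmorphM /= Rc Rc'.
  by move=> u; rewrite -mulrA Cc' mulrA Cc mulrA.
exact: qcomm_mulr.
Qed.

Lemma inert_prod y (I : Type) (s : seq I) (P : pred I) (F : I -> Q) :
  (forall i, P i -> inert y (F i)) -> inert y (\prod_(i <- s | P i) F i).
Proof.
move=> h; apply: (big_ind (inert y)) => //; last exact: inertM.
split; first exact: rmorph1.
by exists 1; rewrite rmorph1 !mul1r mulr1; split=> // u; rewrite mul1r mulr1.
Qed.

Lemma inert_gen a k b : (1 <= k <= m)%N -> k != j -> k != j.+1 ->
  inert (q j.+1 a) (q k b).
Proof.
move=> km kj kj1; split; first exact: (geomR_other geom).
have [z e] := gens_qcomm rel a b (jm : 1 <= j.+1 <= m)%N km.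
have epsC u : eps * u = u * eps by exact: (eps_central rel).
exists (eps ^ z); split=> //.
  by rewrite rmorphXz ?(geomR_eps geom) //; apply: eps_unit rel.
by move=> u; apply/commr_sym/commrXz/commr_sym/epsC.
Qed.

Variables (lam mu : seq nat).
Hypothesis shape : is_skew_shape lam mu.
Variables (r : 'Z_n) (T : filling m lam).
Hypothesis hT : T \in ssyt m lam mu.

Local Notation row := 'I_(size lam).
Local Notation col := 'I_(head 0%N lam).
Local Notation inside := (in_skew lam mu).
Local Notation box := (box_weight q r).
Local Notation colw := (column_weight mu j q r T).

Lemma inert_box a (i : row) (c : col) : inside i c ->
  ~~ active j (T (i, c)) -> inert (q j.+1 a) (box (T (i, c)) i c).
Proof.
have /ssytP[supp _ _] := hT; rewrite -supp => T0 na.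
have Tm := ltn_ord (T (i, c)); rewrite ltnS in Tm.
by apply: inert_gen; rewrite ?T0 //; apply: contraNneq na => ->;
  rewrite /active leqnn leqnSn.
Qed.

Lemma box_j1 (i : row) (c : col) :
  box j.+1 i c = q j.+1 (i%:R - c%:R - j%:R + r + 1 - 1).
Proof. by congr (q _ _); rewrite -natr1; ring. Qed.

Definition above (i : nat) (c : col) : Q :=
  \prod_(i' < size lam | inside i' c && (i' < i)%N) box (T (i', c)) i' c.
Definition below (i : nat) (c : col) : Q :=
  \prod_(i' < size lam | inside i' c && (i < i')%N) box (T (i', c)) i' c.

Lemma lone_column x i c : lone j T i c ->
  colw x c = above i c * (box (if x then j.+1 else j) i c * below i c).
Proof.
move=> l; have /loneP[a u] := l.
have s := active_inside j1 hT a.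
rewrite /column_weight (prod_ord_split _ s); congr (_ * (_ * _)).
- apply: eq_bigr => i' /andP[_ lt]; congr box_weight.
  rewrite /entry; case: ifP => // /loneP[/u e _]; by rewrite e ltnn in lt.
- by rewrite /entry l.
- apply: eq_bigr => i' /andP[_ lt]; congr box_weight.
  rewrite /entry; case: ifP => // /loneP[/u e _]; by rewrite e ltnn in lt.
Qed.

Lemma inert_lone a i c : lone j T i c ->
  inert (q j.+1 a) (above i c) /\ inert (q j.+1 a) (below i c).
Proof.
move=> /loneP[_ u]; split; apply: inert_prod => i' /andP[s lt];
  apply: inert_box => //; apply/negP=> /u e; by rewrite e ltnn in lt.
Qed.

(** The two fillings of the box contribute p_a and s_{a-1}. *)
Lemma lone_column_fixed i c : lone j T i c ->
  R (colw false c + colw true c) = colw false c + colw true c.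
Proof.
move=> l; have [[Ra _] [Rb _]] := inert_lone 0 l.
rewrite !(lone_column _ l) -mulrDr -mulrDl !rmorphM /= Ra Rb box_j1.
by rewrite (R_sum n3 rel).
Qed.

(** A row strictly between two active entries would need an entry strictly
  between j and j + 1. *)
Lemma active_pair (i i' : row) (c : col) : (i < i')%N ->
    active j (T (i, c)) -> active j (T (i', c)) ->
  [/\ T (i, c) = j :> nat, T (i', c) = j.+1 :> nat & i' = i.+1 :> nat].
Proof.
have /ssytP[_ _ cols] := hT => lt a a'.
have s := active_inside j1 hT a; have s' := active_inside j1 hT a'.
have [e e'] := active_lt a a' (cols _ _ _ s s' lt); split=> //.
apply/eqP; rewrite eqn_leq lt andbT leqNgt; apply/negP=> lt2.
have i2 : (i.+1 < size lam)%N by apply: ltn_trans lt2 (ltn_ord _).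
have s2 : inside (Ordinal i2) c.
  by apply: (in_skew_convex shape _ _ s s'); rewrite /= ?leqnn // leqnSn ltnW.
have := cols _ _ _ s s2 (leqnn _); have := cols _ _ _ s2 s' lt2.
by rewrite e e' ltnS leqNgt => /negP.
Qed.

(** The two active entries of the column contribute p_a s_a: going one row down
  raises the content by one, which offsets the step from j to j + 1. *)
Lemma pair_column_fixed (i i' : row) (c : col) : (i < i')%N ->
    active j (T (i, c)) -> active j (T (i', c)) ->
  R (colw false c) = colw false c.
Proof.
move=> lt a a'; have [e e' ii'] := active_pair lt a a'.
have s := active_inside j1 hT a; have s' := active_inside j1 hT a'.
have colwE :
    colw false c = above i c * (box j i c * box j.+1 i' c * below i' c).
  have -> : colw false c = \prod_(i < size lam | inside i c) box (T (i, c)) i c.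
    apply: eq_bigr => i1 s1; congr box_weight; rewrite /entry.
    case: ifP => // /loneP[a1 u]; have := lt.
    by rewrite (u _ a) (u _ a') ltnn.
  rewrite (prod_ord_split _ s) e; congr (_ * _); rewrite -mulrA; congr (_ * _).
  rewrite (@prod_ord_split _ _ _ _ i'); last by rewrite s' lt.
  rewrite big_pred0 => [|i1]; last first.
    by rewrite ii' ltnS -andbA [(i1 <= i)%N]leqNgt andbN andbF.
  rewrite mul1r e'; congr (_ * _); apply: eq_bigl => i1.
  rewrite -andbA; congr andb.
  by apply: andb_idl => /(ltn_trans lt).
have other i1 : i1 != i -> i1 != i' -> ~~ active j (T (i1, c)).
  move=> n1 n1'; apply/negP=> a1; have [lt1|lt1|/val_inj e1] := ltngtP i1 i.
  - by have [_ +] := active_pair lt1 a1 a; rewrite e => /n_Sn.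
  - have [_ _ e1] := active_pair lt1 a a1.
    by case/eqP: n1'; apply: val_inj; rewrite /= e1 ii'.
  - by rewrite e1 eqxx in n1.
have [Ra _] : inert (q j.+1 0) (above i c).
  apply: inert_prod => i1 /andP[s1 lt1]; apply: inert_box => //; apply: other.
    by rewrite -val_eqE /= ltn_eqF.
  by rewrite -val_eqE /= ltn_eqF // (ltn_trans lt1).
have [Rb _] : inert (q j.+1 0) (below i' c).
  apply: inert_prod => i1 /andP[s1 lt1]; apply: inert_box => //; apply: other.
    by rewrite -val_eqE /= gtn_eqF // (ltn_trans lt).
  by rewrite -val_eqE /= gtn_eqF.
have pq : box j i c * box j.+1 i' c =
    q j (i%:R - c%:R - j%:R + r + 1) * q j.+1 (i%:R - c%:R - j%:R + r + 1).
  by congr (_ * q _ _); rewrite ii' -!natr1; ring.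
rewrite colwE rmorphM (rmorphM _ (box _ _ _ * _)) /= Ra Rb pq.
by rewrite (R_mul n3 rel).
Qed.

(** By the number of active entries of the column: one, two, or none. *)
Lemma choice_fixed k :
  R (column_choice mu j q r T k false + column_choice mu j q r T k true) =
  column_choice mu j q r T k false + column_choice mu j q r T k true.
Proof.
rewrite /column_choice; case: insubP => [c _ _|_]; last first.
  by rewrite addr0 rmorph1.
have [/existsP[i l]|nl] := boolP (has_lone j T c).
  exact: lone_column_fixed l.
rewrite /= addr0.
have [/existsP[i a]|/existsPn none] := boolP [exists i, active j (T (i, c))].
  have /existsP[i' /andP[a' ne]] :
      [exists i', active j (T (i', c)) && (i' != i)].
    apply: contraR nl => /existsPn h; apply/existsP; exists i.
    apply/loneP; split=> // i' ai'.
    by apply/eqP; have := h i'; rewrite ai' /= negbK.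
  have [lt|lt|/val_inj e] := ltngtP i' i; last by rewrite e eqxx in ne.
    exact: pair_column_fixed lt a' a.
  exact: pair_column_fixed lt a a'.
suff [] : inert (q j.+1 0) (colw false c) by [].
apply: inert_prod => i s; have -> : entry j T false i c = T (i, c).
  by rewrite /entry; case: ifP => // /loneP[]; rewrite (negbTE (none i)).
exact: inert_box.
Qed.

(** The content drops by one from a box to its right neighbour, so j + 1
  followed by j in a row contributes s_a and p_a with the same index a. *)
Lemma link_fixed k : linked j T k ->
  R (column_choice mu j q r T k true * column_choice mu j q r T k.+1 false) =
  column_choice mu j q r T k true * column_choice mu j q r T k.+1 false.
Proof.
case/existsP=> i /existsP[c /existsP[c' /and4P[/eqP ck /eqP ck' l l']]].
rewrite /column_choice -ck' -ck !valK.
have -> : has_lone j T c by apply/existsP; exists i.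
rewrite /= (lone_column _ l) (lone_column _ l') box_j1.
set a := _ - 1.
have -> : box j i c' = q j a.
  by congr q; rewrite ck' -ck -natr1 /a; ring.
have [[Ra _] iB] := inert_lone a l; have [iA [Rb _]] := inert_lone a l'.
have [Rg [d [Rd dC e]]] := inertM iB iA.
have -> : above i c * (q j.+1 a * below i c) *
      (above i c' * (q j a * below i c')) =
    above i c * (d * (below i c * above i c') * (q j.+1 a * q j a)) *
      below i c'.
  by rewrite -!mulrA (mulrA (below _ _)) (mulrA (q _ _)) e -!mulrA.
have Rps : R (q j.+1 a * q j a) = q j.+1 a * q j a.
  rewrite (s_p rel) // -mulrA rmorphM /= (R_mul n3 rel) //.
  by rewrite rmorphV ?(eps_unit rel) // (geomR_eps geom).
rewrite rmorphM (rmorphM _ (above _ _)) (rmorphM _ (d * _)) (rmorphM _ d) /=.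
by rewrite Rps Ra Rb Rd Rg.
Qed.

End ColumnSums.

(** * Invariance of loop Schur functions *)

Lemma fixed_loop_schur (n m : nat) (Q : unitRingType) (eps : Q)
    (q : nat -> 'Z_n -> Q) (j : nat) (R : {rmorphism Q -> Q}) :
    (3 <= n)%N -> torus_relations m eps q -> (1 <= j < m)%N ->
    is_geometric_R m eps q j R ->
    (forall a, kappa (q j) (q j.+1) a \is a GRing.unit) ->
  forall lam mu r, is_skew_shape lam mu ->
  R (loop_schur m q lam mu r) = loop_schur m q lam mu r.
Proof.
move=> n3 rel /andP[j1 jm] geom kU lam mu r shape.
rewrite /loop_schur (partition_big (collapse jm) xpredT) //= rmorph_sum.
apply: eq_bigr => S _.
have [[T /andP[hT /eqP <-]]|none] := pickP (fun T : filling m lam =>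
  (T \in ssyt m lam mu) && (collapse jm T == S)); last first.
  by rewrite big_pred0 ?rmorph0.
rewrite (fiber_sum shape j1) //; apply: linked_sum_fixed => [c|c].
  exact: (choice_fixed n3 rel).
exact: (link_fixed n3 rel).
Qed.

Lemma torus_relations_morph (n m : nat) (A Q : unitRingType)
    (epsA : A) (qA : nat -> 'Z_n -> A) (eps : Q) (q : nat -> 'Z_n -> Q)
    (f : {rmorphism A -> Q}) :
    torus_relations m epsA qA -> maps_gens m epsA qA eps q f ->
    (forall x : Q, eps * x = x * eps) ->
  torus_relations m eps q.
Proof.
move=> rel [fe fq] epsC; have epsU := eps_unit rel.
have fV k : f (epsA ^- k) = eps ^- k.
  by rewrite rmorphV ?unitrX // rmorphXn /= fe.
split=> //.
- by rewrite -fe rmorph_unit.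
- by move=> j i hj; rewrite -fq // rmorph_unit //; apply: gen_unit rel _ _ hj.
- move=> k j i j' i' hj hj' S S' le; rewrite -!fq // -!rmorphM.
  by rewrite (gen_succ_le rel hj hj' S S' le) !rmorphM /= fe.
- move=> k j i j' i' hj hj' S S' le; rewrite -!fq // -!rmorphM.
  by rewrite (gen_succ_gt rel hj hj' S S' le) !rmorphM /= -[epsA]expr1 fV.
- move=> k j i j' i' hj hj' S S' le; rewrite -!fq // -!rmorphM.
  by rewrite (gen_same_lt rel hj hj' S S' le) !rmorphM /= fV.
- move=> k j i j' i' hj hj' S S' le; rewrite -!fq // -!rmorphM.
  by rewrite (gen_same_gt rel hj hj' S S' le) !rmorphM /= fe.
- move=> j i j' i' hj hj' c c'; rewrite -!fq // -!rmorphM.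
  by rewrite (gen_comm rel).
Qed.

Lemma Q_eps_relations (n m : nat) (Q : unitRingType) (eps : Q)
    (q : nat -> 'Z_n -> Q) :
  is_Q_eps m eps q -> torus_relations m eps q.
Proof.
case=> A [epsA [qA [f [[rel _] [_ _ frac] maps]]]].
apply: (torus_relations_morph rel maps) => x.
have [fe _] := maps; have [a [b [_ ->]]] := frac x.
have C y : GRing.comm eps (f y).
  by rewrite /GRing.comm -fe -!rmorphM (eps_central rel).
by apply: commrM; [|apply: commrV]; apply: C.
Qed.

(** If kappa_a were zero, then so would be the image of the unit p_a, because
  the inverse of 0 is 0 by convention. *)
Lemma kappa_unit (n m : nat) (Q : unitRingType) (eps : Q)
    (q : nat -> 'Z_n -> Q) (j : nat) (R : {rmorphism Q -> Q}) :
    skew_field Q -> torus_relations m eps q -> (1 <= j < m)%N ->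
    is_geometric_R m eps q j R ->
  forall a, kappa (q j) (q j.+1) a \is a GRing.unit.
Proof.
move=> skew rel /andP[j1 jm] geom a; apply: skew; apply/eqP=> k0.
have : R (q j a) \is a GRing.unit.
  by apply/rmorph_unit/(gen_unit rel); rewrite j1 ltnW.
by rewrite (geomR_p geom) k0 invr0 !mul0r unitr0.
Qed.

Theorem theorem6p6 (n m : nat) (hn : (3 <= n)%N) (hm : (2 <= m)%N)
    (Q : unitRingType) (eps : Q) (q : nat -> 'Z_n -> Q)
    (hQ : is_Q_eps m eps q)
    (R : nat -> {rmorphism Q -> Q})
    (hR : forall j, (1 <= j < m)%N -> is_geometric_R m eps q j (R j))
    (lam mu : seq nat) (hshape : is_skew_shape lam mu) (r : 'Z_n) :
  Sym_invariant m R (loop_schur m q lam mu r).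
Proof.
move=> j hj; have rel := Q_eps_relations hQ; have geom := hR j hj.
have [A [epsA [qA [f [_ [skew _ _] _]]]]] := hQ.
have kU := kappa_unit skew rel hj geom.
exact: fixed_loop_schur hn rel hj geom kU _ _ _ hshape.
Qed.
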